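(* Consider the 2D first-order Lax–Friedrichs scheme $$\bar{\mathbf U}_{ij}^{n+1}=\bar{\mathbf U}_{ij}^n-\frac{\Delta t_n}{\Delta x}\Big(\hat{\mathbf F}_1(\bar{\mathbf U}_{ij}^n,\bar{\mathbf U}_{i+1,j}^n)-\hat{\mathbf F}_1(\bar{\mathbf U}_{i-1,j}^n,\bar{\mathbf U}_{ij}^n)\Big)-\frac{\Delta t_n}{\Delta y}\Big(\hat{\mathbf F}_2(\bar{\mathbf U}_{ij}^n,\bar{\mathbf U}_{i,j+1}^n)-\hat{\mathbf F}_2(\bar{\mathbf U}_{i,j-1}^n,\bar{\mathbf U}_{ij}^n)\Big).$$ Let $\alpha_{\ell,n}^{LF}=\chi\max_{ij}\mathscr R_\ell(\bar{\mathbf U}_{ij}^n)$, $\ell=1,2$, with a constant $\chi\ge1$, and $$\Delta t_n=\frac{C}{\alpha_{1,n}^{LF}/\Delta x+\alpha_{2,n}^{LF}/\Delta y},$$ where $C>0$ is the CFL number. For any given constants $\chi\ge1$ and $C>0$, there always exists a set of admissible states $\{\bar{\mathbf U}_{ij}^n\in\mathcal G,\ \forall i,j\}$ such that the solution $\bar{\mathbf U}_{ij}^{n+1}$ of the scheme does not belong to $\mathcal G$ (for some $i,j$). In other words, for any given $\chi$ and $C$, the admissibility of $\{\bar{\mathbf U}_{ij}^n,\forall i,j\}$ does not always guarantee that $\bar{\mathbf U}_{ij}^{n+1}\in\mathcal G$ for all $i,j$.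
   Context: A state is $\mathbf U=(\rho,\mathbf m,\mathbf B,E)^\top\in\mathbb R^8$ with $\rho,E\in\mathbb R$, $\mathbf m,\mathbf B\in\mathbb R^3$. For $\rho>0$ put $\mathbf v=\mathbf m/\rho$, $\mathcal E(\mathbf U)=E-\frac12\big(\frac{|\mathbf m|^2}{\rho}+|\mathbf B|^2\big)$, $e=\mathcal E(\mathbf U)/\rho$, $p=(\gamma-1)\rho e$ (ideal equation of state, adiabatic index $\gamma>1$), $p_{tot}=p+\frac{|\mathbf B|^2}{2}$. Admissible states: $\mathcal G=\{\mathbf U:\rho>0,\ \mathcal E(\mathbf U)>0\}$. Flux: $$\mathbf F_\ell(\mathbf U)=\big(\rho v_\ell,\ \rho v_\ell\mathbf v-B_\ell\mathbf B+p_{tot}\mathbf e_\ell,\ v_\ell\mathbf B-B_\ell\mathbf v,\ v_\ell(E+p_{tot})-B_\ell(\mathbf v\cdot\mathbf B)\big)^\top,$$ with $\mathbf e_\ell$ the $\ell$-th standard unit vector of $\mathbb R^3$. LF flux: $\hat{\mathbf F}_\ell(\mathbf U^-,\mathbf U^+)=\frac12\big(\mathbf F_\ell(\mathbf U^-)+\mathbf F_\ell(\mathbf U^+)-\alpha_{\ell,n}^{LF}(\mathbf U^+-\mathbf U^-)\big)$. Spectral radius: $\mathscr R_\ell(\mathbf U)=|v_\ell|+\mathcal C_\ell$ with $$\mathcal C_\ell=\frac1{\sqrt2}\Big[\mathcal C_s^2+\frac{|\mathbf B|^2}{\rho}+\sqrt{\Big(\mathcal C_s^2+\frac{|\mathbf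 B|^2}{\rho}\Big)^2-4\frac{\mathcal C_s^2B_\ell^2}{\rho}}\Big]^{1/2},\qquad \mathcal C_s=\sqrt{\gamma p/\rho}.$$ The mesh is uniform rectangular with spacings $\Delta x,\Delta y>0$ and cell indices $(i,j)\in\mathbb Z^2$. *)

(* Defs.v *)
From HB Require Import structures.
From mathcomp Require Import all_boot all_order all_algebra.
From mathcomp Require Import reals.
Set Implicit Arguments.
Unset Strict Implicit.
Unset Printing Implicit Defensive.
Import Order.TTheory GRing.Theory Num.Theory.
Local Open Scope ring_scope.

Section IdealMHD.
Context {R : realType}.

Definition dot (u v : 'rV[R]_3) : R := \sum_(k < 3) u 0 k * v 0 k.

(* R^8 is split as (rho, m, B, E); the product inherits the componentwise
   vector-space structure (R^o is R as a vector space over itself). *)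
Definition state : Type := (R^o * 'rV[R]_3 * 'rV[R]_3 * R^o)%type.

Implicit Types (U : state) (gamma : R) (l : 'I_3).

Definition density U : R := U.1.1.1.
Definition momentum U : 'rV[R]_3 := U.1.1.2.
Definition magnetic U : 'rV[R]_3 := U.1.2.
Definition energy U : R := U.2.

(* The quotients by the density below are meaningful only for density U > 0. *)
Definition velocity U : 'rV[R]_3 := (density U)^-1 *: momentum U.

(* rho * e, the internal energy per unit volume *)
Definition internal_energy U : R :=
  energy U - 2^-1 * (dot (momentum U) (momentum U) / density U
                     + dot (magnetic U) (magnetic U)).

Definition specific_internal_energy U : R := internal_energy U / density U.

Definition pressure gamma U : R :=
  (gamma - 1) * density U * specific_internal_energy U.

Definition total_pressure gamma U : R :=
  pressure gamma U + dot (magnetic U) (magnetic U) / 2.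

Definition admissible U : Prop := 0 < density U /\ 0 < internal_energy U.

Definition flux gamma l U : state :=
  let rho := density U in
  let v := velocity U in
  let B := magnetic U in
  let ptot := total_pressure gamma U in
  (rho * v 0 l,
   (rho * v 0 l) *: v - B 0 l *: B + ptot *: delta_mx 0 l,
   v 0 l *: B - B 0 l *: v,
   v 0 l * (energy U + ptot) - B 0 l * dot v B).

Definition sound_speed gamma U : R :=
  Num.sqrt (gamma * pressure gamma U / density U).

Definition fast_speed gamma l U : R :=
  let a := sound_speed gamma U ^+ 2
           + dot (magnetic U) (magnetic U) / density U in
  (Num.sqrt 2)^-1 *
  Num.sqrt (a + Num.sqrt (a ^+ 2
    - 4 * (sound_speed gamma U ^+ 2 * magnetic U 0 l ^+ 2 / density U))).

Definition spectral_radius gamma l U : R :=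
  `|velocity U 0 l| + fast_speed gamma l U.

Definition LF_flux gamma (alpha : R) l (Um Up : state) : state :=
  2^-1 *: (flux gamma l Um + flux gamma l Up - alpha *: (Up - Um)).

Definition dir_x : 'I_3 := @Ordinal 3 0 isT.
Definition dir_y : 'I_3 := @Ordinal 3 1 isT.

(* The mesh is infinite, so a maximum is required to be attained. *)
Definition is_mesh_max (f : int -> int -> R) (M : R) : Prop :=
  (exists i j, f i j = M) /\ (forall i j, f i j <= M).

Definition is_LF_viscosity gamma (chi : R) l (U : int -> int -> state)
    (alpha : R) : Prop :=
  exists2 M, is_mesh_max (fun i j => spectral_radius gamma l (U i j)) M
           & alpha = chi * M.

Definition LF_time_step (C dx dy alpha1 alpha2 : R) : R :=
  C / (alpha1 / dx + alpha2 / dy).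

Definition LF_step gamma (dx dy dt alpha1 alpha2 : R)
    (U : int -> int -> state) (i j : int) : state :=
  U i j
  - (dt / dx) *: (LF_flux gamma alpha1 dir_x (U i j) (U (i + 1) j)
                  - LF_flux gamma alpha1 dir_x (U (i - 1) j) (U i j))
  - (dt / dy) *: (LF_flux gamma alpha2 dir_y (U i j) (U i (j + 1))
                  - LF_flux gamma alpha2 dir_y (U i (j - 1)) (U i j)).

End IdealMHD.

Arguments state R : clear implicits.

(* Main.v *)
Require Import Defs.
From mathcomp Require Import all_boot all_order all_algebra.
From mathcomp Require Import reals.
From mathcomp Require Import ring lra.
Import Order.TTheory GRing.Theory Num.Theory.
Local Open Scope ring_scope.

(** The scheme loses admissibility because nothing forces the discrete
    divergence of B to vanish. In the induction equation the flux of B along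
    e_l contains - B_l v, so wherever B_x jumps by 1 between neighbouring columns a
    transverse velocity w along e_z creates a component B_z' = s w after one
    step, where s = dt / (2 dx). The energy flux, in contrast, does not see w
    as long as B is orthogonal to v and v_x = 0. The new cell thus acquires the
    magnetic energy (s w)^2 / 2, while its total energy grows only by the
    viscous contribution of the jump, which is independent of w; the rest is
    taken from the internal energy.

    A velocity along e_z contributes to no spectral radius in the directions
    e_x and e_y, provided the internal energy is kept fixed. Hence the
    viscosities, the time step and s are independent of w, and letting w grow
    drives the internal energy of the new state below zero whatever chi and C
    are. The initial data are [shear_state w 1] on a single column of cells and
    [shear_state w 0] elsewhere; [spectral_radius_shear] gives the independence
    of w, and [internal_energy_shear_update] the loss of internal energy in the
    cells just left of that column. *)

Definition dir_z : 'I_3 := @Ordinal 3 2 isT.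

(** The energy is chosen so that the internal energy is 1 for all [w] and [b];
    the pressure, and with it the sound speed, then does not depend on [w]. *)
Definition shear_state {R : realType} (w b : R) : state R :=
  (1, w *: delta_mx 0 dir_z, b *: delta_mx 0 dir_x, w ^+ 2 / 2 + b ^+ 2 / 2 + 1).

Section ShearStates.
Context {R : realType}.
Implicit Types (gamma w b : R) (l : 'I_3).

Lemma dotE (u v : 'rV[R]_3) :
  dot u v = u 0 dir_x * v 0 dir_x + u 0 dir_y * v 0 dir_y
            + u 0 dir_z * v 0 dir_z.
Proof.
rewrite /dot !big_ord_recl big_ord0 addr0 addrA.
by congr (u 0 _ * v 0 _ + u 0 _ * v 0 _ + u 0 _ * v 0 _); apply: val_inj.
Qed.

Lemma internal_energy_shear w b : internal_energy (shear_state w b) = 1.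
Proof.
by rewrite /internal_energy /= !dotE /density /momentum /magnetic /energy /=
  !mxE /=; field.
Qed.

Lemma admissible_shear w b : admissible (shear_state w b).
Proof. by split; rewrite ?internal_energy_shear ?ltr01. Qed.

Lemma pressure_shear gamma w b : pressure gamma (shear_state w b) = gamma - 1.
Proof.
rewrite /pressure /specific_internal_energy internal_energy_shear.
by rewrite /density /= divr1 !mulr1.
Qed.

(** The velocity is along [dir_z], and the fast speed sees it only through the
    pressure: the transverse speed [w] can be chosen after the time step. *)
Lemma spectral_radius_shear gamma l w b : l != dir_z ->
  spectral_radius gamma l (shear_state w b) = fast_speed gamma l (shear_state 0 b).
Proof.
move=> lz; rewrite /spectral_radius /velocity /momentum /= !mxE (negPf lz) andbF.
rewrite !mulr0 normr0 add0r.
by rewrite /fast_speed /sound_speed !pressure_shear.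
Qed.

Lemma fast_speed_shear_gt0 gamma l w b : 1 < gamma ->
  0 < fast_speed gamma l (shear_state w b).
Proof.
move=> g1; rewrite /fast_speed /sound_speed pressure_shear /density /= divr1.
have c0 : 0 < gamma * (gamma - 1) by rewrite mulr_gt0 ?subr_gt0 ?(lt_trans ltr01).
apply: mulr_gt0; first by rewrite invr_gt0 sqrtr_gt0 ltr0n.
rewrite sqrtr_gt0 ltr_pwDl ?sqrtr_ge0// ltr_pwDl //; last first.
  by rewrite divr1 dotE -!expr2 !addr_ge0 ?sqr_ge0.
by rewrite sqr_sqrtr // ltW.
Qed.

(** The induction flux carries [- (b * w)] along [dir_z], while the energy flux
    vanishes: a jump of [b] produces magnetic energy that is not paid for. *)
Lemma flux_shear gamma w b :
  flux gamma dir_x (shear_state w b) =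
  (0, (gamma - 1 - b ^+ 2 / 2) *: delta_mx 0 dir_x, - (b * w) *: delta_mx 0 dir_z, 0).
Proof.
rewrite /flux /total_pressure pressure_shear /velocity.
rewrite /density /momentum /magnetic /energy /= !dotE.
rewrite !mxE /= invr1 scale1r.
congr (_, _, _, _); rewrite ?mxE.
- by rewrite !(mulr0, mulr1).
- by apply/rowP => k; rewrite !mxE; field.
- by apply/rowP => k; rewrite !mxE; ring.
- by ring.
Qed.

(** Here [s] stands for half the ratio of time step to mesh width; the term
    [s * w] along [dir_z] is the spurious field due to the jump of B_x. *)
Lemma shear_update gamma s alpha w :
  shear_state w 0
  - s *: (flux gamma dir_x (shear_state w 1) - flux gamma dir_x (shear_state w 0)
          - alpha *: (shear_state w 1 - shear_state w 0)) =
  (1, w *: delta_mx 0 dir_z + (s / 2) *: delta_mx 0 dir_x,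
   (s * alpha) *: delta_mx 0 dir_x + (s * w) *: delta_mx 0 dir_z,
   w ^+ 2 / 2 + 1 + s * alpha / 2).
Proof.
rewrite !flux_shear; congr (_, _, _, _).
- by rewrite /= !subrr scaler0 subr0 scaler0 subr0.
- by apply/rowP => k; rewrite !mxE; field.
- by apply/rowP => k; rewrite !mxE; ring.
- by rewrite /= /GRing.scale /=; field.
Qed.

Lemma internal_energy_shear_update gamma s alpha w :
  internal_energy
    (shear_state w 0
     - s *: (flux gamma dir_x (shear_state w 1) - flux gamma dir_x (shear_state w 0)
             - alpha *: (shear_state w 1 - shear_state w 0))) =
  1 + s * alpha / 2 - ((s / 2) ^+ 2 + (s * alpha) ^+ 2 + (s * w) ^+ 2) / 2.
Proof.
rewrite shear_update /internal_energy !dotE.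
by rewrite /density /momentum /magnetic /energy /= !mxE /=; field.
Qed.

End ShearStates.

(** Where the cell agrees with its other three neighbours, consistency of the
    numerical flux leaves only the contribution of the right interface. *)
Lemma LF_step_jump_right {R : realType} (gamma dx dy dt alpha1 alpha2 : R)
    (U : int -> int -> state R) (i j : int) :
  U (i - 1) j = U i j -> U i (j + 1) = U i j -> U i (j - 1) = U i j ->
  LF_step gamma dx dy dt alpha1 alpha2 U i j =
  U i j - (dt / dx / 2) *: (flux gamma dir_x (U (i + 1) j) - flux gamma dir_x (U i j)
                           - alpha1 *: (U (i + 1) j - U i j)).
Proof.
move=> Uw Un Us; rewrite /LF_step Uw Un Us subrr scaler0 subr0.
rewrite /LF_flux -scalerBr scalerA subrr scaler0 subr0.
congr (_ - _ *: _).
by rewrite addrAC [X in X - _ - _]addrC addrKA.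
Qed.

Theorem theorem4p1 (R : realType) (gamma dx dy : R)
    (hgamma : 1 < gamma) (hdx : 0 < dx) (hdy : 0 < dy)
    (chi C : R) (hchi : 1 <= chi) (hC : 0 < C) :
  exists U : int -> int -> state R,
    (forall i j : int, admissible (U i j)) /\
    exists alpha1 alpha2 : R,
      is_LF_viscosity gamma chi dir_x U alpha1 /\
      is_LF_viscosity gamma chi dir_y U alpha2 /\
      exists i j : int,
        ~ admissible
            (LF_step gamma dx dy (LF_time_step C dx dy alpha1 alpha2)
               alpha1 alpha2 U i j).
Proof.
pose M l := Num.max (fast_speed gamma l (shear_state 0 0))
                    (fast_speed gamma l (shear_state 0 1)).
have chi0 : 0 < chi by exact: lt_le_trans ltr01 hchi.
have a0 l : 0 < chi * M l by rewrite mulr_gt0 // lt_max fast_speed_shear_gt0.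
pose alpha1 := chi * M dir_x; pose alpha2 := chi * M dir_y.
pose s := LF_time_step C dx dy alpha1 alpha2 / dx / 2.
have s0 : 0 < s by rewrite !divr_gt0 // addr_gt0 // divr_gt0 ?a0.
(* Since w enters nothing above, it may be adjusted to s and alpha1 so that
   (s * w)^2 exceeds twice the available energy 1 + s * alpha1 / 2. *)
pose w := (2 + s * alpha1) / s.
pose U (i j : int) := shear_state w (i == 1)%:R.
have visc l : l != dir_z -> is_LF_viscosity gamma chi l U (chi * M l).
  move=> lz; exists (M l) => //; split=> [|i j]; last first.
    by rewrite spectral_radius_shear // le_max; case: (i == 1); rewrite lexx ?orbT.
  rewrite /M; case: leP => _.
    by exists 1, 0; rewrite spectral_radius_shear.
  by exists 0, 0; rewrite spectral_radius_shear.
exists U; split=> [i j|]; first exact: admissible_shear.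
exists alpha1, alpha2; split; [exact: visc|split; [exact: visc|]].
exists 0, 0; case=> _; apply/negP; rewrite -leNgt.
rewrite LF_step_jump_right // -/s /U /= internal_energy_shear_update.
have -> : s * w = 2 + s * alpha1 by rewrite /w mulrC divfK // gt_eqF.
have sa : 0 < s * alpha1 by rewrite mulr_gt0 // a0.
nra.
Qed.
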